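(* Let $K\subseteq\mathbb{R}^n$ be a convex body and let $\Lambda\subseteq\mathbb{R}^n$ be an $n$-dimensional lattice. Then for all $1\le i\le n$, $$\frac{1}{\lambda_i(K_c^\star,\Lambda^\star)}\le \rho_i(K,\Lambda)\le \lambda_{n-i+1}(K_c,\Lambda).$$ Moreover, the upper bound always holds with equality for $i=n$, and the lower bound always holds with equality for $i=1$.
   Context: A convex body in $\mathbb{R}^n$ is a compact convex set with non-empty interior. An $n$-dimensional lattice is a set $\Lambda=B\mathbb{Z}^n$ with $B\in\mathbb{R}^{n\times n}$ invertible. $K_c=K-K=\{x-y:x,y\in K\}$ is the difference body. Polarity: $M^\star=\{y\in\mathbb{R}^n:\langle x,y\rangle\le 1\ \forall x\in M\}$ for a convex body $M$ (so $K_c^\star$ is the polar of $K_c$), and $\Lambda^\star=\{a\in\mathbb{R}^n:\langle b,a\rangle\in\mathbb{Z}\ \forall b\in\Lambda\}$. Successive minima: for an origin-symmetric convex body $M=-M$, $\lambda_i(M,\Lambda)=\min\{\lambda>0:\dim(\lambda M\cap\Lambda)\ge i\}$, $1\le i\le n$, where $\dim$ of a set is the dimension of its affine hull; i.e. the least $\lambda$ such that $\lambda M$ contains $i$ linearly independent lattice points. Packing minima: for $1\le i\le n$, $\rho_i(K,\Lambda)=\inf\{\rho>0:(\rho K_c+L)\cap\Lambda\neq L\cap\Lambda\text{ for all }(n-i)\text{-dimensional linear subspaces }L\subseteq\mathbb{R}^n\}$. Equivalently, $\rho_i(K,\Lambda)=\max\lambda_1(K_c|L^\perp,\Lambda|L^\perp)$,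 the maximum over all $(n-i)$-dimensional linear lattice planes $L$ of $\Lambda$ (linear subspaces $L$ with $\dim L=\dim(L\cap\Lambda)=n-i$), where $\cdot|L^\perp$ is orthogonal projection onto $L^\perp$ and $\lambda_1$ is taken in the $i$-dimensional Euclidean space $L^\perp$. *)

(* Defs.v *)
From HB Require Import structures.
From mathcomp Require Import all_boot all_order all_algebra.
From mathcomp Require Import all_classical all_reals all_analysis.

Set Implicit Arguments.
Unset Strict Implicit.
Unset Printing Implicit Defensive.

Import Order.TTheory GRing.Theory Num.Theory.
Import numFieldNormedType.Exports.

Local Open Scope classical_set_scope.
Local Open Scope ring_scope.

Section GeometryOfNumbers.
Variables (R : realType) (n : nat).
Local Notation V := 'cV[R]_n.
Implicit Types (K M S L : set V) (r l : R) (i d : nat).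

Definition convex_body K := [/\ compact K, convex_set K & K° !=set0].

Definition is_lattice L := exists2 B : 'M[R]_n, B \in unitmx &
  L = [set B *m map_mx intr z | z in [set: 'cV[int]_n]].

Definition inner (x y : V) : R := \sum_(j < n) x j 0 * y j 0.

Definition minkowski_sum S M : set V := [set x + y | x in S & y in M].

Definition dilate r M : set V := [set r *: x | x in M].

Definition difference_body K : set V := [set x - y | x in K & y in K].

Definition polar M : set V := [set y | forall x, M x -> inner x y <= 1].

Definition dual_lattice L : set V :=
  [set a | forall b, L b -> inner b a \is a Num.int].

Definition affine_hull S : set V :=
  [set x | exists (m : nat) (p : 'I_m -> V) (c : 'I_m -> R),
    [/\ forall j, S (p j), \sum_(j < m) c j = 1 & x = \sum_(j < m) c j *: p j]].

(* The empty set has no dimension in this sense. *)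
Definition affine_dim S d := exists (p : V) (U : {vspace V}),
  affine_hull S = [set p + u | u in [set` U]] /\ \dim U = d.

Definition is_minimum (A : set R) r := A r /\ lbound A r.

(* An actual minimum, not an infimum; it defaults to 0 when none exists, which
   does not happen for the symmetric convex bodies M, lattices L and
   1 <= i <= n for which successive minima are considered. *)
Definition successive_minimum i M L : R :=
  xget 0 (is_minimum [set l | 0 < l /\
    exists2 d, affine_dim (dilate l M `&` L) d & (i <= d)%N]).

Definition packing_minimum i K L : R :=
  inf [set r | 0 < r /\ forall U : {vspace V}, \dim U = (n - i)%N ->
    minkowski_sum (dilate r (difference_body K)) [set` U] `&` L
      <> [set` U] `&` L].

End GeometryOfNumbers.

(* Main.v *)
(* A lattice point b lies in rho K_c + L but not in L exactly when it projects
   to a nonzero point of rho K_c modulo L.  Upper bound: among n - i + 1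
   independent lattice points of lambda K_c, one misses the (n-i)-dimensional L.
   Lower bound: take for L the orthogonal complement of i independent points a_j
   of mu K_c^* in the dual lattice; a lattice point b outside L that lies in
   rho K_c + L has, for some j, |<b, a_j>| >= 1 (a nonzero integer) and
   |<b, a_j>| <= rho mu.
   That the successive minima are attained follows from the finiteness of the
   set of lattice points in a bounded set, where one minimizes the largest gauge
   over the free tuples of lattice points. *)
Require Import Defs.
From HB Require Import structures.
From mathcomp Require Import all_boot all_order all_algebra.
From mathcomp Require Import all_classical all_reals all_analysis.
From mathcomp Require Import lra ring.

Set Implicit Arguments.
Unset Strict Implicit.
Unset Printing Implicit Defensive.

Import Order.TTheory GRing.Theory Num.Theory.
Import numFieldNormedType.Exports.

Local Open Scope classical_set_scope.
Local Open Scope ring_scope.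

(** * Orthogonal complements *)

Section InnerProduct.
Variables (R : realType) (n : nat).
Local Notation V := 'cV[R]_n.
Implicit Types (x y a : V) (X : seq V) (U : {vspace V}).

Lemma innerC x y : inner x y = inner y x.
Proof. by apply: eq_bigr => j _; rewrite mulrC. Qed.

Lemma innerDl x y a : inner (x + y) a = inner x a + inner y a.
Proof.
by rewrite /inner -big_split; apply: eq_bigr => j _; rewrite mxE mulrDl.
Qed.

Lemma innerZl t x a : inner (t *: x) a = t * inner x a.
Proof. by rewrite /inner mulr_sumr; apply: eq_bigr => j _; rewrite mxE mulrA. Qed.

Lemma innerNl x a : inner (- x) a = - inner x a.
Proof. by rewrite -scaleN1r innerZl mulN1r. Qed.

Lemma innerBl x y a : inner (x - y) a = inner x a - inner y a.
Proof. by rewrite innerDl innerNl. Qed.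

Lemma innerZr t x a : inner x (t *: a) = t * inner x a.
Proof. by rewrite !(innerC x) innerZl. Qed.

Lemma inner0l a : inner 0 a = 0.
Proof. by rewrite -(scale0r 0) innerZl mul0r. Qed.

Lemma inner_deltal (j : 'I_n) a : inner (delta_mx j 0) a = a j 0.
Proof.
rewrite /inner (bigD1 j) //= mxE !eqxx mul1r big1 ?addr0 // => k kj.
by rewrite mxE (negbTE kj) mul0r.
Qed.

Lemma inner_mulmx x y : inner x y = (x^T *m y) 0 0.
Proof. by rewrite mxE; apply: eq_bigr => j _; rewrite mxE. Qed.

Let rows_of X : 'M[R]_(size X, n) := \matrix_(j, k) X`_j k 0.

Let mul_rows_of X x (j : 'I_(size X)) : (rows_of X *m x) j 0 = inner X`_j x.
Proof. by rewrite mxE; apply: eq_bigr => k _; rewrite mxE. Qed.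

Let eval_rows X : 'Hom('cV[R]_n, 'cV[R]_(size X)) := linfun (mulmx (rows_of X)).

Definition perp X : {vspace V} := lker (eval_rows X).

Lemma mem_perp X x : (x \in perp X) = all (fun a => inner a x == 0) X.
Proof.
rewrite memv_ker lfunE /=; apply/eqP/allP => [X0 a aX|X0].
  have iX : (index a X < size X)%N by rewrite index_mem.
  by rewrite -(nth_index 0 aX) -(mul_rows_of _ (Ordinal iX)) X0 mxE.
by apply/colP => j; rewrite mul_rows_of mxE; apply/eqP/X0/mem_nth.
Qed.

Let dim_cV k : (\dim {:'cV[R]_k} = k)%N.
Proof. by rewrite dimvf dim_matrix; exact: muln1. Qed.

Lemma dim_perp_ge X : (n - size X <= \dim (perp X))%N.
Proof.
have := limg_ker_dim (eval_rows X) fullv.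
rewrite capfv dim_cV => dimE; rewrite leq_subLR -[leqLHS]dimE addnC leq_add2r.
by rewrite (leq_trans (dimvS (subvf _))) // dim_cV.
Qed.

(** Rank-nullity: freeness makes the matrix with rows [X] row-free, and its right inverse shows that
    evaluation is surjective. *)
Lemma dim_perp X : free X -> \dim (perp X) = (n - size X)%N.
Proof.
move=> freeX; set f := eval_rows X.
have := limg_ker_dim f fullv; rewrite capfv dim_cV => dimE.
suff img : (f @: fullv)%VS = fullv.
  by rewrite -[X in (X - _)%N]dimE img dim_cV addnK.
have /row_freeP[B AB] : row_free (rows_of X).
  apply: inj_row_free => v vX0; apply/rowP => j; rewrite mxE.
  apply: (freeP (X := in_tuple X) freeX (fun j => v 0 j)) => {j}.
  apply/colP => k; have := congr1 (fun w : 'rV[R]_n => w 0 k) vX0.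
  rewrite !mxE => <-; rewrite summxE; apply: eq_bigr => j _.
  by rewrite !mxE.
apply/eqP; rewrite eqEsubv subvf; apply/subvP => y _.
have -> : y = f (B *m y) by rewrite lfunE /= mulmxA AB mul1mx.
by rewrite memv_img // memvf.
Qed.

(* A hyperplane is the orthogonal complement of any nonzero vector orthogonal
   to a basis of it. *)
Lemma hyperplane_normal U : (0 < n)%N -> \dim U = (n - 1)%N ->
  exists2 a, a != 0 & forall x, (x \in U) = (inner x a == 0).
Proof.
move=> n0 dU; have szB : size (vbasis U) = (n - 1)%N by rewrite size_tuple.
have [a0|[a [aB a0]]] : perp (vbasis U) = 0%VS \/
    exists a, a \in perp (vbasis U) /\ a != 0.
- have [->|P0] := eqVneq (perp (vbasis U)) 0%VS; first by left.
  by right; exists (vpick (perp (vbasis U))); rewrite memv_pick vpick0.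
(* A zero complement would force [n - (n - 1) = 1] to be at most 0. *)
- have := dim_perp_ge (vbasis U); rewrite a0 dimv0 szB subKn //.
have Ua : (U <= perp [:: a])%VS.
  rewrite -(span_basis (vbasisP U)); apply/span_subvP => u uB.
  rewrite mem_perp /= andbT innerC.
  by move: aB; rewrite mem_perp => /allP/(_ _ uB).
have /eqP UE : U == perp [:: a].
  by rewrite eqEdim Ua dim_perp ?seq1_free //= dU.
by exists a => // x; rewrite UE mem_perp /= andbT innerC.
Qed.

End InnerProduct.

(** * Affine dimension and free families *)

Section AffineDim.
Variables (R : realType) (n : nat).
Local Notation V := 'cV[R]_n.
Implicit Types (S : set V) (X : seq V) (i : nat).

(** For [S] containing 0 this expresses that the affine dimension is at least [i] ([affine_dimP]),
    without mentioning hulls. *)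
Definition has_free S i :=
  exists X, [/\ size X = i, free X & forall x, x \in X -> S x].

Lemma has_free_le S i j : (i <= j)%N -> has_free S j -> has_free S i.
Proof.
move=> ij [X [sX fX XS]]; exists (take i X); split.
- by rewrite size_takel // sX.
- by apply: (@catl_free _ _ (drop i X)); rewrite cat_take_drop.
- by move=> x /mem_take/XS.
Qed.

(** A longest free sequence in [S] works: a point of [S] outside its span could be adjoined. *)
Lemma max_free S : exists X, [/\ free X, forall x, x \in X -> S x
  & forall x, S x -> x \in <<X>>%VS].
Proof.
have ex0 : exists i, `[< has_free S i >].
  by exists 0%N; apply/asboolP; exists [::]; rewrite nil_free.
have ub i : `[< has_free S i >] -> (i <= \dim {:V})%N.
  by move=> /asboolP[X [<- fX _]]; rewrite -(eqP fX) dimvS // subvf.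
have [i /asboolP[X [sX fX XS]] imax] := ex_maxnP ex0 ub.
exists X; split=> // x Sx; apply: contraT => xX.
suff /imax : `[< has_free S i.+1 >] by rewrite ltnn.
apply/asboolP; exists (x :: X); split; rewrite /= ?sX //.
  by rewrite free_cons xX.
by move=> y; rewrite inE => /orP[/eqP->|/XS].
Qed.

Lemma affine_hull_span S X : S 0 -> (forall x, x \in X -> S x) ->
  (forall x, S x -> x \in <<X>>%VS) -> affine_hull S = [set` <<X>>%VS].
Proof.
move=> S0 XS SX; apply/seteqP; split=> x /=.
  by case=> m [p [c [pS _ ->]]]; apply: memv_suml => j _; rewrite memvZ // SX.
move=> xX; pose m := size X; pose c j := coord (in_tuple X) j x.
(* The extra point 0, with the weight missing to 1, turns a linear combination into an affine
   one. *)
exists m.+1, (fun j => if unlift ord0 j is Some k then X`_k else 0).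
exists (fun j => if unlift ord0 j is Some k then c k else 1 - \sum_k c k).
split.
- by move=> j; case: unliftP => [k _|_] //; apply/XS/mem_nth.
- rewrite big_ord_recl unlift_none; under [X in _ + X]eq_bigr do rewrite liftK.
  by rewrite subrK.
- rewrite big_ord_recl unlift_none scaler0 add0r.
  under eq_bigr do rewrite liftK.
  exact: (coord_span (X := in_tuple X)).
Qed.

(** The hull is the span of a maximal free family; a translate [p + U] equal to this linear subspace
    must have [U] equal to it as well. *)
Lemma affine_dimP S i : S 0 ->
  (exists2 d, affine_dim S d & (i <= d)%N) <-> has_free S i.
Proof.
move=> S0; have [X [fX XS SX]] := max_free S.
have hullE := affine_hull_span S0 XS SX; split.
- case=> d [p [U [hU dU]]] id; apply: (@has_free_le _ _ d) => //.
  have pX u : (u \in U) = (p + u \in <<X>>%VS).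
    apply/idP/idP => [uU|puX].
      suff : [set` <<X>>%VS] (p + u) by [].
      by rewrite -hullE hU; exists u.
    have : affine_hull S (p + u) by rewrite hullE.
    by rewrite hU => -[w /= wU /addrI <-].
  have p0X : p \in <<X>>%VS by have := mem0v U; rewrite pX addr0.
  have UE : U = <<X>>%VS by apply/vspaceP => u; rewrite pX rpredDl.
  by exists X; split=> //; rewrite -(eqP fX) -dU UE.
- case=> Y [sY fY YS]; exists (\dim <<X>>%VS).
    exists 0, <<X>>%VS; split=> //; rewrite hullE.
    apply/seteqP; split=> x /=; first by exists x; rewrite ?add0r.
    by case=> u uX <-; rewrite add0r.
  rewrite -sY -(eqP fY) dimvS //; apply/span_subvP => y /YS; exact: SX.
Qed.

End AffineDim.

(** * Star bodies and gauges *)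

Section StarBody.
Variables (R : realType) (n : nat).
Local Notation V := 'cV[R]_n.
Implicit Types (M K : set V) (x y : V) (l t : R).

(* Closedness is only required along rays from the origin: this makes the
   predicate stable under polarity without any topology. *)
Record star_body M : Prop := StarBody {
  star_shaped : forall x t, M x -> 0 <= t <= 1 -> M (t *: x);
  star_closed : forall x, (forall t, 0 <= t < 1 -> M (t *: x)) -> M x;
  star_bounded : exists C : R, forall x j, M x -> `|x j 0| <= C;
  star_absorbing : forall x, exists2 l, 0 < l & M (l^-1 *: x) }.

Lemma dilateP M l x : 0 < l -> dilate l M x <-> M (l^-1 *: x).
Proof.
move=> l0; split=> [[y My <-]|Mx]; last first.
  by exists (l^-1 *: x) => //; rewrite scalerA divff ?gt_eqF // scale1r.
by rewrite scalerA mulVf ?gt_eqF // scale1r.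
Qed.

Lemma star_body0 M : star_body M -> M 0.
Proof.
by move=> sM; have [l _] := star_absorbing sM 0; rewrite scaler0.
Qed.

Definition gauge M x : R := inf [set l | 0 < l /\ M (l^-1 *: x)].

(** The infimum is attained: closedness along the ray reduces the claim to factors [t < 1], where an
    admissible [k] with [t * k <= l] suffices by star-shapedness. *)
Lemma gaugeP M x l : star_body M -> 0 < l ->
  M (l^-1 *: x) <-> gauge M x <= l.
Proof.
move=> sM l0; split=> [Mx|gl].
  by apply: ge_inf => //; exists 0 => r [/ltW].
apply: (star_closed sM) => t /andP[t0 t1].
have [k k0 [Mk tk]] : exists2 k, 0 < k & M (k^-1 *: x) /\ t * k <= l.
  have [->|tn0] := eqVneq t 0.
    by have [k k0 Mk] := star_absorbing sM x; exists k => //; rewrite mul0r ltW.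
  have tgt0 : 0 < t by rewrite lt_neqAle eq_sym tn0.
  have [||k [k0 Mk] kl] := @inf_lt _ [set l | 0 < l /\ M (l^-1 *: x)] (l / t).
  - by have [k k0 Mk] := star_absorbing sM x; exists k.
  - by rewrite (le_lt_trans gl) // ltr_pdivlMr // gtr_pMr.
  by exists k => //; split=> //; rewrite mulrC -ler_pdivlMr // ltW.
have -> : t *: (l^-1 *: x) = (t * k / l) *: (k^-1 *: x).
  by rewrite !scalerA; congr (_ *: _); field; rewrite !gt_eqF.
apply: (star_shaped sM) => //; rewrite ler_pdivrMr // mul1r tk andbT.
by rewrite divr_ge0 ?mulr_ge0 // ltW.
Qed.

Lemma gauge_gt0 M x : star_body M -> x != 0 -> 0 < gauge M x.
Proof.
move=> sM; have [C MC] := star_bounded sM.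
case/cV0Pn => j xj0; have xj : 0 < `|x j 0| by rewrite normr_gt0.
have lbP l : 0 < l -> M (l^-1 *: x) -> `|x j 0| <= l * C.
  move=> l0 /MC-/(_ j); rewrite mxE normrM normfV (gtr0_norm l0).
  by rewrite ler_pdivrMl.
have [l l0 Ml] := star_absorbing sM x.
have C0 : 0 < C by have := lt_le_trans xj (lbP l l0 Ml); rewrite pmulr_rgt0.
apply: (@lt_le_trans _ _ (`|x j 0| / C)); first by rewrite divr_gt0.
apply: lb_le_inf; first by exists l.
by move=> k [k0 Mk]; rewrite ler_pdivrMr //; exact: lbP.
Qed.

(** Polarity exchanges two axioms: absorption of the vectors [± e_j] by [M] bounds the coordinates
    of the polar, and boundedness of [M] makes the polar absorbing. *)
Lemma star_body_polar M : star_body M -> star_body (polar M).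
Proof.
move=> sM; split.
- move=> y t My /andP[t0 t1] x /My; rewrite innerZr => xy.
  have [xy0|xy0] := lerP 0 (inner x y).
    by rewrite (le_trans _ xy) // ler_piMl.
  by rewrite (le_trans _ ler01) // mulr_ge0_le0 // ltW.
- move=> y Hy x Mx; rewrite leNgt; apply/negP => xy1.
  set v := inner x y in xy1.
  have v0 : 0 < v by rewrite (lt_trans ltr01).
  (* This factor is below 1, yet its product with [v] is [(1 + v) / 2], which still exceeds 1. *)
  have /Hy/(_ x Mx) : 0 <= (1 + v) / (2 * v) < 1.
    by rewrite divr_ge0 /= ?ltr_pdivrMr; lra.
  rewrite innerZr -/v; suff -> : (1 + v) / (2 * v) * v = (1 + v) / 2 by lra.
  by field; rewrite gt_eqF.
- have /choice[l lP] : forall j, exists l, 0 < l /\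
      M (l^-1 *: delta_mx j 0) /\ M (l^-1 *: - delta_mx j 0).
    move=> j; have [l1 l10 M1] := star_absorbing sM (delta_mx j 0).
    have [l2 l20 M2] := star_absorbing sM (- delta_mx j 0).
    have aux l x : 0 < l -> l <= l1 + l2 -> M (l^-1 *: x) ->
        M ((l1 + l2)^-1 *: x).
      move=> l0 ll /(gaugeP x sM l0) gl; apply/(gaugeP x sM); first lra.
      exact: le_trans ll.
    exists (l1 + l2); split; first lra.
    by split; [apply: (aux l1) | apply: (aux l2)] => //; lra.
  exists (\big[Num.max/0]_j l j) => y j My.
  apply: le_trans (le_bigmax _ _ j).
  have [lj0 [Mp Mn]] := lP j; rewrite ler_norml.
  move/(_ _ Mp): (My); move/(_ _ Mn): (My).
  rewrite !innerZl innerNl inner_deltal => yn yp; apply/andP; split.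
    by rewrite lerNl -[leRHS]mulr1 -ler_pdivrMl.
  by rewrite -[leRHS]mulr1 -ler_pdivrMl.
- move=> y; have [C MC] := star_bounded sM.
  pose D := \sum_j `|C| * `|y j 0|.
  have D0 : 0 <= D by apply: sumr_ge0 => j _; rewrite mulr_ge0.
  exists (D + 1); first lra.
  move=> x Mx; rewrite innerZr ler_pdivrMl ?mulr1; last lra.
  suff : inner x y <= D by lra.
  apply: ler_sum => j _; apply: le_trans (ler_norm _) _.
  by rewrite normrM ler_wpM2r // (le_trans (MC _ _ Mx)) // ler_norm.
Qed.

Lemma difference_bodyN K x : difference_body K x -> difference_body K (- x).
Proof.
by case=> a Ka [b Kb <-]; exists b => //; exists a => //; rewrite opprB.
Qed.

(** Convexity gives star-shapedness, compactness (as a continuous image of [K * K]) gives closedness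
    and boundedness, and an interior point gives absorption. *)
Lemma star_body_difference K : convex_body K -> star_body (difference_body K).
Proof.
case=> cK convK [p pK].
have Kconv a b t : K a -> K b -> 0 <= t <= 1 -> K (t *: a + (1 - t) *: b).
  move=> Ka Kb /andP[t0 t1].
  have := convK a b (Itv01 t0 t1); rewrite !inE; exact.
have cM : compact (difference_body K).
  have -> : difference_body K = (fun z : V * V => z.1 - z.2) @` (K `*` K).
    apply/seteqP; split=> x [/=].
      by move=> a Ka [b Kb <-]; exists (a, b).
    by case=> a b [/= Ka Kb] <-; exists a => //; exists b.
  apply: continuous_compact; last exact: compact_setX.
  exact/continuous_subspaceT/sub_continuous.
split.
- move=> _ t [a Ka [b Kb <-]] t01.
  exists (t *: a + (1 - t) *: b); first exact: Kconv.
  by exists b => //; rewrite scalerBr scalerBl scale1r addrA addrAC addrK.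
- move=> x Mx; have Mclosed := compact_closed (@norm_hausdorff _ V) cM.
  apply: (@closed_cvg _ _ (1 : R)^'- _ (fun t => t *: x) _ Mclosed).
    near=> t; apply: Mx; apply/andP; split.
      by near: t; apply: nbhs_left_ge.
    by near: t; exact: nbhs_left_lt.
  rewrite -[X in _ --> X]scale1r; apply: cvgZr_tmp.
  exact: cvg_at_left_filter.
- have [C [_ /(_ (C + 1))]] := compact_bounded cM.
  rewrite ltrDl ltr01 => /(_ isT) MC; exists (C + 1) => x j /MC; apply: le_trans.
  rewrite (_ : `|x| = mx_norm x) // mx_normrE.
  exact: (le_bigmax _ (fun ij => `|x ij.1 ij.2|) (j, 0)).
- move=> x.
  (* For small [s > 0] the point [p + s x] stays in [K], so [s x = (p + s x) - p] lies in the
     difference body. *)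
  have px : p + s *: x @[s --> (0 : R)^'+] --> p.
    rewrite -[X in _ --> X]addr0 -(scale0r x); apply: cvgD; first exact: cvg_cst.
    by apply: cvgZr_tmp; exact: cvg_at_right_filter.
  near ((0 : R)^'+) => s.
  have s0 : 0 < s by near: s; exact: nbhs_right_gt.
  exists s^-1; first by rewrite invr_gt0.
  exists (p + s *: x); first by near: s; exact: px.
  by exists p; [exact: interior_subset | rewrite invrK addrC addKr].
Unshelve. all: by end_near. Qed.

End StarBody.

(** * Lattices and successive minima *)

Section Lattice.
Variables (R : realType) (n : nat).
Local Notation V := 'cV[R]_n.
Implicit Types (L M : set V) (x y a : V) (l : R) (i : nat).

Lemma lattice_sub L x y : is_lattice L -> L x -> L y -> L (x - y).
Proof.
case=> B _ -> [z _ <-] [w _ <-]; exists (z - w) => //.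
by rewrite map_mxB mulmxBr.
Qed.

Lemma lattice0 L : is_lattice L -> L 0.
Proof. by case=> B _ ->; exists 0 => //; rewrite map_mx0 mulmx0. Qed.

Lemma latticeZ L x (k : int) : is_lattice L -> L x -> L (k%:~R *: x).
Proof.
by case=> B _ -> [z _ <-]; exists (k *: z); rewrite // map_mxZ scalemxAr.
Qed.

Lemma lattice_span L : is_lattice L -> has_free L n.
Proof.
case=> B uB ->; exists [seq col j B | j <- enum 'I_n]; split.
- by rewrite size_map size_enum_ord.
- have szX : size [seq col j B | j <- enum 'I_n] == n.
    by rewrite size_map size_enum_ord.
  apply/(freeP (X := Tuple szX)) => k k0 j.
  suff /colP/(_ j) : \col_j k j = 0 by rewrite !mxE.
  apply: (can_inj (mulKmx uB)); rewrite mulmx0 -k0.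
  apply/colP => r; rewrite !mxE summxE; apply: eq_bigr => s _.
  by rewrite !mxE (nth_map s) ?size_enum_ord // nth_ord_enum mxE mulrC.
- move=> _ /mapP[j _ ->]; exists (delta_mx j 0) => //.
  by rewrite map_delta_mx -colE.
Qed.

Lemma lattice_inner_neq0 L a : is_lattice L -> a != 0 ->
  exists2 b, L b & inner b a != 0.
Proof.
case=> B uB -> a0; have uBT : B^T \in unitmx by rewrite unitmx_tr.
have /cV0Pn[j Ba0] : B^T *m a != 0.
  by apply: contra_neq a0 => Ba; rewrite -[a](mulKmx uBT) Ba mulmx0.
exists (B *m map_mx intr (delta_mx j 0 : 'cV[int]_n)).
  by exists (delta_mx j 0).
by rewrite map_delta_mx inner_mulmx trmx_mul -mulmxA -inner_mulmx inner_deltal.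
Qed.

(** The inverse transpose of [B] is a basis of the dual: the coordinates of [B^T a] are the pairings
    of [a] with the columns of [B]. *)
Lemma is_lattice_dual L : is_lattice L -> is_lattice (dual_lattice L).
Proof.
case=> B uB ->; have uBT : B^T \in unitmx by rewrite unitmx_tr.
exists (invmx B^T); first by rewrite unitmx_inv.
have innerE z a : inner (B *m map_mx intr z) a = inner (map_mx intr z) (B^T *m a).
  by rewrite !inner_mulmx trmx_mul mulmxA.
apply/seteqP; split=> a /=.
  move=> aP; exists (map_mx Num.floor (B^T *m a)) => //.
  rewrite -[RHS](mulKmx uBT); congr (_ *m _); apply/colP => j; rewrite 2!mxE.
  apply: floorK; rewrite -inner_deltal.
  have := aP (B *m map_mx intr (delta_mx j 0 : 'cV[int]_n)).
  by rewrite innerE map_delta_mx; apply;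
    exists (delta_mx j 0) => //; rewrite map_delta_mx.
case=> w _ <- _ [z _ <-]; rewrite innerE mulKVmx // rpred_sum // => j _.
by rewrite !mxE rpredM // intr_int.
Qed.

(* Lattice points in a bounded set are finitely many: they are images of
   vectors of bounded naturals, shifted by a constant. *)
Lemma lattice_bounded_finite L (C : R) : is_lattice L ->
  exists N (pt : 'cV['I_N]_n -> V), (forall z, L (pt z)) /\
    forall x, L x -> (forall j, `|x j 0| <= C) -> exists z, pt z = x.
Proof.
case=> B uB LE.
(* [D] bounds every coordinate of [invmx B *m x] at once, that is, the integer coordinates of a
   lattice point [x] in the box. *)
pose D := \sum_j \sum_k `|invmx B j k| * `|C|; pose m := Num.bound D.
pose pt (z : 'cV['I_(m + m).+1]_n) := B *m map_mx intr
  (\col_j ((z j 0 : nat)%:Z - m%:Z)).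
exists (m + m).+1, pt; split=> [z|x].
  by rewrite LE; exists (\col_j ((z j 0 : nat)%:Z - m%:Z)).
rewrite LE => -[z _ zx] xC.
have D0 : 0 <= D.
  by rewrite sumr_ge0 // => j _; rewrite sumr_ge0 // => k _; rewrite mulr_ge0.
have zm j : `|z j 0| < m%:Z.
  rewrite -(ltr_int R) intr_norm; apply: le_lt_trans (archi_boundP D0).
  have -> : (z j 0)%:~R = (invmx B *m x) j 0 by rewrite -zx mulKmx // mxE.
  rewrite mxE; apply: le_trans (ler_norm_sum _ _ _) _.
  apply: le_trans (_ : \sum_k `|invmx B j k| * `|C| <= _).
    apply: ler_sum => k _; rewrite normrM ler_wpM2l //.
    exact: le_trans (xC k) (ler_norm _).
  rewrite /D [leRHS](bigD1 j) //= lerDl sumr_ge0 // => k _.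
  by rewrite sumr_ge0 // => s _; rewrite mulr_ge0.
exists (\col_j inord (absz (z j 0 + m%:Z))).
rewrite /pt -zx; congr (_ *m map_mx _ _); apply/colP => j; rewrite !mxE.
have := zm j; rewrite ltr_norml => /andP[z1 z2].
have zm0 : 0 <= z j 0 + m%:Z by rewrite -lerBlDr sub0r ltW.
rewrite inordK; first by rewrite gez0_abs // addrK.
by rewrite ltnS -lez_nat gez0_abs // PoszD lerD2r ltW.
Qed.

Lemma seq_preimage (T1 : Type) (T2 : eqType) (f : T1 -> T2) (X : seq T2) :
  (forall w, w \in X -> exists z, f z = w) -> exists Z, map f Z = X.
Proof.
elim: X => [|x X IH] XP; first by exists [::].
have [z zx] := XP x (mem_head _ _).
have [|Z ZX] := IH; first by move=> y yX; apply: XP; rewrite inE yX orbT.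
by exists (z :: Z); rewrite /= zx ZX.
Qed.

Lemma min_free_exists M L i : star_body M -> is_lattice L -> (1 <= i <= n)%N ->
  exists l, is_minimum [set l | 0 < l /\ has_free (dilate l M `&` L) i] l.
Proof.
move=> sM lL /andP[i1 iN].
have gP x l : 0 < l -> dilate l M x <-> gauge M x <= l.
  by move=> l0; rewrite dilateP //; exact: gaugeP.
have [X0 [sX0 fX0 X0L]] := has_free_le iN (lattice_span lL).
(* An admissible scale, from which the search starts; the summand 1 makes it positive. *)
pose l0 : R := 1 + \big[Num.max/0]_(x <- X0) gauge M x.
have l0gt0 : 0 < l0.
  by rewrite ltr_pwDl // bigmax_idl le_max lexx.
have X0l x : x \in X0 -> gauge M x <= l0.
  move=> xX; rewrite /l0 -[leLHS]add0r lerD // le_bigmax_seq //.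
have [C MC] := star_bounded sM.
have [N [pt [ptL ptX]]] := lattice_bounded_finite (l0 * C) lL.
have lift X : size X = i -> (forall x, x \in X -> L x /\ gauge M x <= l0) ->
    exists T : i.-tuple 'cV['I_N]_n, map pt T = X.
  move=> sX XP; have [|Z ZX] := @seq_preimage _ _ pt X.
    move=> x /XP[Lx gx]; apply: ptX => // j.
    have := MC _ j ((gaugeP x sM l0gt0).2 gx).
    by rewrite mxE normrM normfV (gtr0_norm l0gt0) ler_pdivrMl.
  have sZ : size Z == i by rewrite -sX -ZX size_map.
  by exists (Tuple sZ).
have [T0 T0X] := lift _ sX0 (fun x xX => conj (X0L x xX) (X0l x xX)).
pose P (T : i.-tuple 'cV['I_N]_n) := free (map pt T).
pose G (T : i.-tuple 'cV['I_N]_n) :=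
  \big[Num.max/0]_(j < i) gauge M (pt (tnth T j)).
have PT0 : P T0 by rewrite /P T0X.
have GP T l : 0 < l -> G T <= l <-> (forall x, x \in map pt T -> dilate l M x).
  move=> lgt0; split=> [/bigmax_leP[_ Gl] _ /mapP[z /tnthP[j ->] ->]|Tl].
    by apply/gP => //; exact: Gl.
  apply/bigmax_leP; split=> [|j _]; first exact: ltW.
  by apply/gP => //; apply: Tl; rewrite map_f // mem_tnth.
have [T PT Tmin] := arg_minP G PT0.
(* A free family has no zero vector, and [1 <= i] provides a member. *)
have GT0 : 0 < G T.
  have pt0 : pt (tnth T (Ordinal i1)) != 0.
    apply/eqP => pt0; have : 0 \in map pt T by rewrite -pt0 map_f // mem_tnth.
    by move/(free_not0 PT); rewrite eqxx.
  apply: lt_le_trans (gauge_gt0 sM pt0) _.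
  exact: (le_bigmax _ (fun j => gauge M (pt (tnth T j)))).
exists (G T); split=> [|l [lgt0 [X [sX fX XP]]]].
  split=> //; exists (map pt T); split=> [||x xT].
  - by rewrite size_map size_tuple.
  - exact: PT.
  - by split; [exact: (GP T _ GT0).1 | case/mapP: xT => z _ ->].
(* Scales from [l0] on are dominated by [T0]; below [l0] the competing points have gauge at most
   [l0], hence are enumerated by [pt]. *)
have [l0l|ll0] := lerP l0 l.
  apply: le_trans (Tmin _ PT0) _; apply/GP => // x; rewrite T0X => /X0l gx.
  by apply/gP => //; exact: le_trans l0l.
have [|T1 T1X] := lift _ sX.
  by move=> x /XP[xl Lx]; split=> //; apply: le_trans (ltW ll0); exact/gP.
apply: le_trans (Tmin T1 _) _; first by rewrite /P T1X.
by apply/GP => // x; rewrite T1X => /XP[].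
Qed.

(** Both the dilate and the lattice contain 0, so [affine_dimP] applies; existence of the minimum
    rules out the default value of [xget]. *)
Lemma successive_minimumP M L i : star_body M -> is_lattice L ->
  (1 <= i <= n)%N ->
  is_minimum [set l | 0 < l /\ has_free (dilate l M `&` L) i]
    (successive_minimum i M L).
Proof.
move=> sM lL iP; rewrite /successive_minimum.
have -> : [set l | 0 < l /\
      exists2 d, affine_dim (dilate l M `&` L) d & (i <= d)%N]
    = [set l | 0 < l /\ has_free (dilate l M `&` L) i].
  apply/seteqP; split=> l [l0 lP]; split=> //; apply/affine_dimP => //;
    by split; [exists 0; [exact: star_body0 | rewrite scaler0] | exact: lattice0].
by apply: xgetPex; exact: min_free_exists.
Qed.

End Lattice.

(** * Packing minima *)

Section PackingMinimum.
Variables (R : realType) (n : nat).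
Local Notation V := 'cV[R]_n.
Implicit Types (K L M : set V) (U : {vspace V}) (i : nat) (r l : R).

(** Since 0 is in [M], the points of [L] in [U] always lie in the left-hand set, so the two sets can
    differ only by a lattice point outside [U]. *)
Lemma packing_neqP M L U r : M 0 ->
  minkowski_sum (dilate r M) [set` U] `&` L <> [set` U] `&` L <->
  exists b m, [/\ L b, b \notin U, M m & b - r *: m \in U].
Proof.
move=> M0; split=> [neq|[b [m [Lb bU Mm bmU]]] /seteqP[/(_ b)]].
  apply: contrapT => noP; apply: neq; apply/seteqP; split=> b [/=].
    case=> _ [m Mm <-] [u /= uU <-] Lb; split=> //.
    apply: contrapT => /negP bU; apply: noP; exists (r *: m + u), m; split=> //.
    by rewrite addrAC subrr add0r.
  move=> bU Lb; split=> //; exists 0; last by exists b; rewrite ?add0r.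
  by exists 0; rewrite ?scaler0.
move=> sub _; move: bU; apply/negP; rewrite negbK.
suff [] : ([set` U] `&` L) b by [].
apply: sub; split=> //; exists (r *: m); first by exists m.
by exists (b - r *: m) => //; rewrite addrC subrK.
Qed.

Definition separating K L i := [set r | 0 < r /\
  forall U : {vspace V}, \dim U = (n - i)%N ->
  minkowski_sum (dilate r (difference_body K)) [set` U] `&` L <> [set` U] `&` L].

Lemma separating_ge K L i r : separating K L i r -> packing_minimum i K L <= r.
Proof. by move=> sr; apply: ge_inf => //; exists 0 => s [/ltW]. Qed.

Lemma separating_has_free K L i l : convex_body K -> 0 < l ->
  has_free (dilate l (difference_body K) `&` L) (n - i + 1) ->
  separating K L i l.
Proof.
move=> cK l0 [X [sX fX XS]]; split=> // U dU.
have M0 := star_body0 (star_body_difference cK); apply/packing_neqP => //.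
(* The [n - i + 1] independent points cannot all fit in the [(n - i)]-dimensional [U]. *)
have /allPn[x xX xU] : ~~ all (fun x => x \in U) X.
  apply/negP => /allP XU; have /dimvS : (<<X>> <= U)%VS by apply/span_subvP.
  by rewrite (eqP fX) sX dU addn1 ltnn.
have [[m Mm mx] Lx] := XS x xX.
by exists x, m; split=> //; rewrite mx subrr mem0v.
Qed.

Lemma separating_ge_inv K L i r l : convex_body K -> 0 < l ->
  has_free (dilate l (polar (difference_body K)) `&` dual_lattice L) i ->
  separating K L i r -> 1 / l <= r.
Proof.
move=> cK l0 [X [sX fX XS]] [r0 /(_ (perp X))].
rewrite dim_perp // sX => /(_ erefl).
have M0 := star_body0 (star_body_difference cK).
move=> /(packing_neqP _ _ _ M0)[b [m [Lb + Mm]]].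
rewrite !mem_perp => /allPn[a aX ab0] /allP/(_ a aX).
have [[y My ya] aL] := XS a aX.
rewrite innerC innerBl subr_eq0 innerZl => /eqP bm.
have ba1 : 1 <= `|inner b a|.
  rewrite innerC in ab0; have := aL b Lb => /intrP[k bk].
  move: ab0; rewrite bk -intr_norm ler1z intr_eq0 -absz_gt0.
  by case: (k) => [[]|].
(* The polar condition bounds only one side; symmetry of the difference body gives the other. *)
have my : `|inner m y| <= 1.
  rewrite ler_norml My // andbT lerNl -innerNl; exact/My/difference_bodyN.
rewrite ler_pdivrMr //; apply: le_trans ba1 _.
rewrite bm -ya innerZr !normrM (gtr0_norm r0) (gtr0_norm l0) ler_pM2l //.
by rewrite ger_pMr.
Qed.

(* If the hyperplane orthogonal to [a] defeats [r], then no nonzero value of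
   [b |-> <b, a>] on the lattice is smaller than [r h], where [h] is the support
   function of [K - K] at [a].  These values are thus the multiples of some
   [p >= r h], and [a / p] is a dual lattice vector of polar gauge
   [h / p <= 1 / r]. *)
Lemma separating1 K L r : convex_body K -> is_lattice L -> (0 < n)%N ->
  1 / successive_minimum 1 (polar (difference_body K)) (dual_lattice L) < r ->
  separating K L 1 r.
Proof.
move=> cK lL n0; set mu := successive_minimum _ _ _ => mur.
have sM := star_body_difference cK; have sP := star_body_polar sM.
set M := difference_body K in sM sP *.
have [[mu0 _] muP] : is_minimum _ mu :=
  successive_minimumP (i := 1) sP (is_lattice_dual lL) n0.
have r0 : 0 < r by apply: lt_trans mur; rewrite divr_gt0.
split=> // U dU; apply/(packing_neqP _ _ _ (star_body0 sM)).
have [a a0 Ua] := hyperplane_normal n0 dU.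
apply: contrapT => noP.
pose h := gauge (polar M) a; have h0 : 0 < h := gauge_gt0 sP a0.
have Gge b : L b -> inner b a != 0 -> r * h <= `|inner b a|.
  move=> Lb ba0; rewrite leNgt; apply/negP => lt_h; apply: noP.
  (* As [s < h], some [m] in [M] pairs with [a] to more than [s]; shrunk to the value [s], it makes
     [b - r m] or [b + r m] orthogonal to [a], according to the sign of the pairing with [b]. *)
  pose s := `|inner b a| / r.
  have s0 : 0 < s by rewrite divr_gt0 // normr_gt0.
  have sh : s < h by rewrite ltr_pdivrMr // mulrC.
  have [m Mm sm] : exists2 m, M m & s < inner m a.
    apply: contrapT => nom; have : gauge (polar M) a <= s.
      apply/gaugeP => // m Mm; rewrite innerZr ler_pdivrMl // mulr1 leNgt.
      by apply/negP => sm; apply: nom; exists m.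
    by rewrite leNgt sh.
  have ma0 : 0 < inner m a by rewrite (lt_trans s0).
  have Mm' : M ((s / inner m a) *: m).
    apply: (star_shaped sM) => //; apply/andP; split.
      by rewrite divr_ge0 // ltW.
    by rewrite ler_pdivrMr // mul1r ltW.
  have E : inner ((s / inner m a) *: m) a = s by rewrite innerZl divfK // gt_eqF.
  have rs : r * s = `|inner b a| by rewrite mulrC divfK // gt_eqF.
  have [ba|ba] := lerP 0 (inner b a).
    exists b, ((s / inner m a) *: m); split=> //; first by rewrite Ua.
    by rewrite Ua innerBl innerZl E rs ger0_norm // subrr.
  exists b, (- ((s / inner m a) *: m)); split=> //; first by rewrite Ua.
    exact: difference_bodyN.
  by rewrite Ua innerBl innerZl innerNl E mulrN rs ltr0_norm // opprK subrr.
pose G : set R := [set g | 0 < g /\ exists2 b, L b & inner b a = g].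
have G0 : G !=set0.
  have [b Lb ba0] := lattice_inner_neq0 lL a0.
  have [ba|ba|ba] := ltgtP (inner b a) 0; last by rewrite ba eqxx in ba0.
    exists (- inner b a); split; first by rewrite oppr_gt0.
    exists (- b); last by rewrite innerNl.
    by rewrite -sub0r; apply: lattice_sub => //; exact: lattice0.
  by exists (inner b a); split=> //; exists b.
have Grh g : G g -> r * h <= g.
  case=> g0 [b Lb bg]; have := Gge b Lb.
  by rewrite bg gt_eqF // gtr0_norm // => /(_ isT).
have rh0 : 0 < r * h by rewrite mulr_gt0.
(* No attained minimum of [G] is required: a nonzero remainder modulo [p] and its complement to [p]
   would both lie in [G], one at least [inf G], the other at least [r * h], though they sum to
   [p < inf G + r * h]. *)
have [|p [p0 [c Lc cp]] pG] := @inf_lt _ G (inf G + r * h) G0.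
  by rewrite ltrDl.
have infG g : G g -> inf G <= g by apply: ge_inf; exists 0 => s [/ltW].
have dual b : L b -> exists k : int, inner b a = k%:~R * p.
  move=> Lb; pose k := Num.floor (inner b a / p); exists k.
  have Lbk : L (b - k%:~R *: c) by apply: lattice_sub => //; exact: latticeZ.
  have /andP[k1 k2] := floor_itv (inner b a / p); rewrite -/k in k1 k2.
  have rem : inner (b - k%:~R *: c) a = inner b a - k%:~R * p.
    by rewrite innerBl innerZl cp.
  have rem_ge0 : 0 <= inner b a - k%:~R * p by rewrite subr_ge0 -ler_pdivlMr.
  have rem_lt : inner b a - k%:~R * p < p.
    by move: k2; rewrite ltr_pdivrMr // intrD mulrDl mul1r ltrBlDl.
  apply/eqP; rewrite -subr_eq0; apply: contraT => rem0.
  have Grem : G (inner b a - k%:~R * p).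
    by split; [rewrite lt_neqAle eq_sym rem0 | exists (b - k%:~R *: c)].
  have Gp : G (p - (inner b a - k%:~R * p)).
    split; first by rewrite subr_gt0.
    exists (c - (b - k%:~R *: c)); first exact: lattice_sub.
    by rewrite innerBl cp rem.
  have := infG _ Grem; have := Grh _ Gp; lra.
have hp0 : 0 < h / p by rewrite divr_gt0.
have /muP : 0 < h / p /\ has_free (dilate (h / p) (polar M) `&` dual_lattice L) 1.
  split=> //; exists [:: p^-1 *: a]; split=> //.
    by rewrite seq1_free scaler_eq0 invr_eq0 gt_eqF.
  move=> x; rewrite inE => /eqP->; split.
    apply/dilateP => //.
    have -> : (h / p)^-1 *: (p^-1 *: a) = h^-1 *: a.
      by rewrite scalerA; congr (_ *: _); field; rewrite !gt_eqF.
    exact/gaugeP.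
  move=> b Lb; have [k bk] := dual b Lb.
  by rewrite innerZr bk mulrC mulfK ?gt_eqF // intr_int.
(* The contradiction is [h / p <= 1 / r < mu], against the minimality of [mu]. *)
apply/negP; rewrite -ltNge; apply: le_lt_trans (_ : r^-1 < mu).
  rewrite ler_pdivrMr // ler_pdivlMl //; apply: Grh; split=> //.
  by exists c.
by rewrite -[r^-1]mul1r ltr_pdivrMr // -ltr_pdivrMl // mulrC -div1r mul1r.
Qed.

End PackingMinimum.

(** * Comparison of packing minima with successive minima *)

Unset Implicit Arguments.

Theorem proposition1p1 (R : realType) (n : nat) (K Lambda : set 'cV[R]_n)
    (hK : convex_body K) (hLambda : is_lattice Lambda)
    (i : nat) (hi : (1 <= i <= n)%N) :
  [/\ 1 / successive_minimum i (polar (difference_body K)) (dual_lattice Lambda)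
        <= packing_minimum i K Lambda,
      packing_minimum i K Lambda
        <= successive_minimum (n - i + 1) (difference_body K) Lambda,
      i = n -> packing_minimum i K Lambda
        = successive_minimum (n - i + 1) (difference_body K) Lambda
    & i = 1%N ->
        1 / successive_minimum i (polar (difference_body K)) (dual_lattice Lambda)
        = packing_minimum i K Lambda].
Proof.
have sM := star_body_difference hK.
have /andP[i1 iN] := hi.
have hj : (1 <= n - i + 1 <= n)%N by rewrite addn1 /= ltn_subrL i1 (leq_trans i1).
have [[l0 lfree] lmin] := successive_minimumP sM hLambda hj.
have [[m0 mfree] _] :=
  successive_minimumP (star_body_polar sM) (is_lattice_dual hLambda) hi.
have lsep := separating_has_free hK l0 lfree.
have lower : 1 / successive_minimum i (polar (difference_body K))
    (dual_lattice Lambda) <= packing_minimum i K Lambda.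
  apply: lb_le_inf; first by eexists; exact: lsep.
  by move=> r; exact: separating_ge_inv.
split=> //; first exact: separating_ge.
- move=> iE; apply/eqP; rewrite eq_le separating_ge //=.
  apply: lb_le_inf; first by eexists; exact: lsep.
  move=> r [r0 rP].
  (* For [i = n] the only subspace to test is 0, which yields a nonzero lattice point [b = r m], as
     the first minimum demands. *)
  have /rP : \dim (0%VS : {vspace 'cV[R]_n}) = (n - i)%N.
    by rewrite dimv0 iE subnn.
  move=> /(packing_neqP _ _ _ (star_body0 sM))[b [m [Lb b0 Mm]]].
  rewrite memv0 subr_eq0 => /eqP bm.
  apply: lmin; split=> //; exists [:: b]; split.
  + by rewrite iE subnn.
  + by rewrite seq1_free -memv0.
  + by move=> x; rewrite inE => /eqP->; split=> //; exists m.
- move=> iE; apply/eqP; rewrite eq_le lower /=.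
  (* [separating1] requires a strict inequality, hence the slack [e]. *)
  apply/ler_addgt0Pr => e e0; apply: separating_ge; rewrite iE.
  by apply: separating1; rewrite // ?(leq_trans i1) // ltrDl.
Qed.
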